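(* Consider the renewal system and the iterative algorithm described in the context. Let $(t^*,r^* )\in\overline{\mathcal{A}}$ satisfy $\theta^*=r^*/t^*$ and assume that $\overline{\mathcal{A}}$ has strongly concave curvature at this point: for some constant $c>0$, $$r\le r^*+\theta^*(t-t^* )-\frac{c}{2}(t-t^* )^2\qquad\text{for all }(t,r)\in\overline{\mathcal{A}}.$$ Run the algorithm with deterministic $\theta[0]\in[\theta_{min},\theta_{max}]$ and stepsizes $\eta[k]=\frac{1}{(k+2)T_{min}}$ for $k\in\{0,1,2,\ldots\}$. Then for all $K\in\{2,3,4,\ldots\}$, $$\left|\theta^*-\frac{\sum_{k=0}^{K-1}\mathbb{E}[R[k]]}{\sum_{k=0}^{K-1}\mathbb{E}[T[k]]}\right|\le\frac{2(\theta[0]-\theta^* )^2+\frac{4b}{T_{min}^2}\big(1+\log(K-1)\big)}{K\,c\,T_{min}},$$ and so the deviation from the optimal ratio $\theta^*$ decays like $O(\log(K)/K)$.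
   Context: System: $\{S[k]\}_{k=0}^\infty$ is an i.i.d. sequence of random vectors with values in $\Omega_S\subseteq\mathbb{R}^m$. For each $s\in\Omega_S$, $\mathcal{D}(s)$ is a compact subset of $(0,\infty)\times(-\infty,\infty)$. On each frame $k\in\{0,1,2,\ldots\}$ a decision $(T[k],R[k])\in\mathcal{D}(S[k])$ is chosen; $T[k]$ and $R[k]$ are random variables (measurable). There are functions $L,M:\Omega_S\to[0,\infty)$ with $t\ge L(s)$ and $t^2+r^2\le M(s)$ for all $(t,r)\in\mathcal{D}(s)$, $s\in\Omega_S$, such that $L(S[0]),M(S[0])$ are random variables with $\mathbb{E}[L(S[0])]>0$ and $\mathbb{E}[M(S[0])]<\infty$. Consequently there are constants $T_{min}>0$, $T_{max}$, $R_{min}$, $R_{max}$, $C_1$, $C_2$ (fixed throughout) such that, regardless of how decisions are made, for all $k$: $T_{min}\le\mathbb{E}[T[k]]\le T_{max}$, $R_{min}\le\mathbb{E}[R[k]]\le R_{max}$, $\mathbb{E}[T[k]^2]\le C_1$, $\mathbb{E}[R[k]^2]\le C_2$. Optimal ratio: $\mathcal{A}\subseteq\mathbb{R}^2$ is the set of all one-shot expectations $(\mathbb{E}[T[0]],\mathbb{E}[R[0]])$ achievable on frame $0$ over all (measurable, possibly randomized) conditional distributions for choosing $(T[0],R[0])\in\mathcal{D}(S[0])$ given $S[0]$; $\overline{\mathcal{A}}$ is its closure. $\theta^*=\sup_{(t,r)\in\overline{\mathcal{A}}}\{r/t\}$, and this supremum is attained. The finite constants $\theta_{min},\theta_{max}$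 satisfy $\theta_{min}\le\theta^*\le\theta_{max}$. Algorithm: given deterministic $\theta[0]\in[\theta_{min},\theta_{max}]$ and deterministic positive stepsizes $\{\eta[k]\}$, on each frame $k$: observe $S[k]$ and $\theta[k]$; choose $(T[k],R[k])\in\mathcal{D}(S[k])$ to maximize $R[k]-\theta[k]T[k]$ (ties broken by an arbitrary rule making $(T[k],R[k])$ a measurable function of $(\theta[k],S[k])$); then update $\theta[k+1]=\big[\theta[k]+\eta[k](R[k]-\theta[k]T[k])\big]_{\theta_{min}}^{\theta_{max}}$, where $[x]_{\theta_{min}}^{\theta_{max}}$ is the projection of $x$ onto $[\theta_{min},\theta_{max}]$. The constant $b$ satisfies $\frac12\mathbb{E}[(R[k]-\theta[k]T[k])^2]\le b$ for all $k\in\{0,1,2,\ldots\}$ under this algorithm. $\log$ is the natural logarithm. *)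

(* Defs.v *)
From HB Require Import structures.
From mathcomp Require Import all_boot all_order all_algebra finmap.
From mathcomp Require Import all_classical all_reals all_analysis.

Set Implicit Arguments.
Unset Strict Implicit.
Unset Printing Implicit Defensive.

Import Order.TTheory GRing.Theory Num.Theory.
Import numFieldNormedType.Exports.

Local Open Scope classical_set_scope.
Local Open Scope ring_scope.

Section iid.
Context {d d' : measure_display} {W : measurableType d} {V : measurableType d'}
  {R : realType} (P : probability W R).

Definition mutually_independent (X : nat -> {RV P >-> V}) : Prop :=
  forall (J : {fset nat}) (A : nat -> set V), (forall i, measurable (A i)) ->
    P (\bigcap_(i in [set` J]) X i @^-1` A i) =
    (\prod_(i <- J) P (X i @^-1` A i))%E.

Definition identically_distributed (X : nat -> {RV P >-> V}) : Prop :=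
  forall k (A : set V), measurable A ->
    distribution P (X k) A = distribution P (X 0%N) A.

Definition iid (X : nat -> {RV P >-> V}) : Prop :=
  mutually_independent X /\ identically_distributed X.

End iid.

(* A state s is an m-tuple of reals (its product sigma-algebra is the Borel one
   of R^m); a decision is a pair z with duration z.1 and reward z.2.
   [D s] and [L s], [M s] are only ever constrained for s in Omega. *)
Section renewal.
Context {d : measure_display} {W : measurableType d} {R : realType}
  (P : probability W R) (m : nat).
Variables (Omega : set (m.-tuple R)) (D : m.-tuple R -> set (R * R))
  (S : nat -> {RV P >-> m.-tuple R}).

Record renewal_system (L M : m.-tuple R -> R) : Prop := {
  state_iid : iid S;
  state_in : forall k w, Omega (S k w);
  D_compact : forall s, Omega s -> compact (D s);
  D_gt0 : forall s z, Omega s -> D s z -> 0 < z.1;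
  L_ge0 : forall s, Omega s -> 0 <= L s;
  M_ge0 : forall s, Omega s -> 0 <= M s;
  D_geL : forall s z, Omega s -> D s z -> L s <= z.1;
  D_leM : forall s z, Omega s -> D s z -> z.1 ^+ 2 + z.2 ^+ 2 <= M s;
  L_measurable : measurable_fun [set: W] (L \o S 0%N);
  M_measurable : measurable_fun [set: W] (M \o S 0%N);
  L_mean : (0 < 'E_P[L \o S 0%N])%E;
  M_mean : ('E_P[M \o S 0%N] < +oo)%E
}.

(* Conditional law of a possibly randomized decision given the observed state.
   Taking the kernel on all of R^m loses no generality: a kernel on Omega (with
   its trace sigma-algebra) into R^2 extends measurably to R^m. *)
Definition decision_law (kappa : R.-pker (m.-tuple R) ~> (R * R)%type) : Prop :=
  forall s, Omega s -> kappa s (D s) = 1%E.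

(* E[f(T[k],R[k])] when (T[k],R[k]) has conditional law kappa given S[k]. *)
Definition frame_mean (k : nat) (kappa : R.-pker (m.-tuple R) ~> (R * R)%type)
    (f : R * R -> R) : \bar R :=
  (\int[P]_w \int[kappa (S k w)]_z (f z)%:E)%E.

Record moment_bounds (Tmin Tmax Rmin Rmax C1 C2 : R) : Prop := {
  Tmin_gt0 : 0 < Tmin;
  T_bounds : forall k kappa, decision_law kappa ->
    (Tmin%:E <= frame_mean k kappa (fun z => z.1) <= Tmax%:E)%E;
  R_bounds : forall k kappa, decision_law kappa ->
    (Rmin%:E <= frame_mean k kappa (fun z => z.2) <= Rmax%:E)%E;
  T2_bound : forall k kappa, decision_law kappa ->
    (frame_mean k kappa (fun z => (z.1 ^+ 2)%R) <= C1%:E)%E;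
  R2_bound : forall k kappa, decision_law kappa ->
    (frame_mean k kappa (fun z => (z.2 ^+ 2)%R) <= C2%:E)%E
}.

Definition achievable : set (R * R) :=
  [set x | exists2 kappa, decision_law kappa &
     x.1%:E = frame_mean 0 kappa (fun z => z.1) /\
     x.2%:E = frame_mean 0 kappa (fun z => z.2)].

Definition optimal_ratio : R := sup [set x.2 / x.1 | x in closure achievable].

Definition proj_itv (a b x : R) : R := Num.max a (Num.min x b).

(* The rule phi maps (theta, s) to a maximizer of z.2 - theta * z.1 over D s.
   It is measurable on all of R * R^m but only constrained for theta in
   [thmin, thmax] and s in Omega; any measurable tie-breaking rule on that set
   extends in this way. *)
Definition argmax_rule (thmin thmax : R) (phi : R * m.-tuple R -> R * R) : Prop :=
  measurable_fun setT phi /\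
  forall th s, thmin <= th <= thmax -> Omega s ->
    D s (phi (th, s)) /\
    forall z, D s z -> z.2 - th * z.1 <= (phi (th, s)).2 - th * (phi (th, s)).1.

Record adaptive_run (thmin thmax theta0 : R) (eta : nat -> R)
    (phi : nat -> R * m.-tuple R -> R * R)
    (T Rw theta : nat -> {RV P >-> R}) : Prop := {
  run_rule : forall k, argmax_rule thmin thmax (phi k);
  run_decision : forall k w, (T k w, Rw k w) = phi k (theta k w, S k w);
  run_init : forall w, theta 0%N w = theta0;
  run_update : forall k w, theta k.+1 w =
    proj_itv thmin thmax
      (theta k w + eta k * (Rw k w - theta k w * T k w))
}.

End renewal.

Definition ratio_of_means {d : measure_display} {W : measurableType d}
    {R : realType} (P : probability W R) (T Rw : nat -> {RV P >-> R})
    (K : nat) : R :=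
  (\sum_(0 <= k < K) fine 'E_P[Rw k]) / (\sum_(0 <= k < K) fine 'E_P[T k]).

(* Main.v *)
(* For fixed th, let (t, r) be the mean of the frame decided by the rule
   phi k (th, -).  It is achievable, so curvature gives
     r <= thstar * t - c/2 * (t - tstar)^2,
   while maximality of the rule against every achievable point, hence against
   (tstar, rstar), gives (thstar - th) * tstar <= r - th * t.  Together,
     0 <= thstar * t - r <= 2/c * (th - thstar)^2,
     (th - thstar) * (r - th * t) <= - Tmin * (th - thstar)^2.
   As theta k is a function of S 0, ..., S (k - 1), it is independent of S k, so
   by Fubini both estimates can be averaged over theta k.  The second one is the
   drift of z k = E[(theta k - thstar)^2]: with beta = 2 b / Tmin^2,
     z (k+1) <= k/(k+2) * z k + beta/(k+2)^2,
   whence z k <= beta/k for k > 0.  Summing the first one over k < K bounds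
   thstar * sum E[T] - sum E[R] by 2/c * sum z k, which is logarithmic in K,
   whereas sum E[T] >= K * Tmin. *)

Require Import Defs.
From HB Require Import structures.
From mathcomp Require Import all_boot all_order all_algebra finmap.
From mathcomp Require Import all_classical all_reals all_analysis.
From mathcomp Require Import measurable_realfun.
From mathcomp Require Import ring lra.

Set Implicit Arguments.
Unset Strict Implicit.
Unset Printing Implicit Defensive.

Import Order.TTheory GRing.Theory Num.Theory.
Import numFieldNormedType.Exports.

Local Open Scope classical_set_scope.
Local Open Scope ring_scope.

(** * Borel sets of the plane and integrability *)

Section plane_borel.
Context {R : realType}.

Lemma open_measurable_prod (U : set (R * R)) : open U -> measurable U.
Proof.
move=> oU.
pose V (p q : rat) :=
  [set x : R | forall y, ratr p < y < ratr q -> U (x, y)]^°.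
have -> : U = \bigcup_(p : rat) \bigcup_(q : rat)
    (V p q `*` [set` `]ratr p, ratr q[%R]).
  apply/seteqP; split => [[x y] Uxy|[x y] [p _ [q _ [/= /interior_subset Vx]]]].
    have [[A B] /= [Ax By] AB] : nbhs (x, y) U by exact: open_nbhs_nbhs.
    have [e /= e0 eB] := By.
    have /rat_in_itvoo[p] : y - e < y by rewrite ltrBlDr ltrDl.
    have /rat_in_itvoo[q] : y < y + e by rewrite ltrDl.
    rewrite !in_itv/= => /andP[yq qe] /andP[ep py].
    exists p => //; exists q => //; split; last by rewrite /= in_itv/= py yq.
    apply: (filterS _ Ax) => z Az t /andP[pt tq]; apply: AB; split => //=.
    by apply: eB; rewrite /ball_/= ltr_distlC (lt_trans ep pt) (lt_trans tq qe).
  by rewrite in_itv/=; exact: Vx.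
apply: bigcupT_measurable_rat => p; apply: bigcupT_measurable_rat => q.
apply: measurableX; last exact: measurable_itv.
by apply: open_measurable; exact: open_interior.
Qed.

Lemma compact_measurable_prod (K : set (R * R)) : compact K -> measurable K.
Proof.
move=> cK; rewrite -[K]setCK; apply: measurableC; apply: open_measurable_prod.
apply: closed_openC; apply: compact_closed => //; exact: norm_hausdorff.
Qed.
End plane_borel.

Section integrable_finite.
Local Open Scope ereal_scope.
Context {d} {T : measurableType d} {R : realType}.

(* Works because +oo - +oo = -oo in \bar R. *)
Lemma fin_num_integrable (mu : {measure set T -> \bar R}) (f : T -> \bar R) :
  measurable_fun setT f -> \int[mu]_x f x \is a fin_num ->
  mu.-integrable setT f.
Proof.
move=> mf; rewrite integralE => fn; apply/integrableP; split => //.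
have p0 : 0 <= \int[mu]_x f^\+ x.
  by apply: integral_ge0 => x _; rewrite funeposE le_max lexx orbT.
have n0 : 0 <= \int[mu]_x f^\- x.
  by apply: integral_ge0 => x _; rewrite funenegE le_max lexx orbT.
have -> : \int[mu]_x `|f x| = \int[mu]_x f^\+ x + \int[mu]_x f^\- x.
  rewrite -ge0_integralD//=.
  - by rewrite -[X in integral _ _ X]/(abse \o f) fune_abse.
  - exact: measurable_funepos.
  - exact: measurable_funeneg.
move: fn p0 n0; case: (\int[mu]_x f^\+ x) => [p| |];
  by case: (\int[mu]_x f^\- x) => [n| |] //=; rewrite ltry.
Qed.

End integrable_finite.

(** * Independence of the past and the current state *)

Section independence.
Local Open Scope ereal_scope.

Lemma finite_measure_rect_unique {d1 d2} {T1 : measurableType d1}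
    {T2 : measurableType d2} {R : realType}
    (m1 m2 : {measure set (T1 * T2) -> \bar R}) : m1 setT < +oo ->
  (forall A B, measurable A -> measurable B -> m1 (A `*` B) = m2 (A `*` B)) ->
  forall X, measurable X -> m1 X = m2 X.
Proof.
move=> m1oo m12 X mX.
apply: (measure_unique [set A `*` B | A in measurable & B in measurable]
  (fun=> setT)) => //.
- exact: measurable_prod_measurableType.
- move=> _ _ [A mA [B mB <-]] [A' mA' [B' mB' <-]]; rewrite -setXI.
  exists (A `&` A'); first exact: measurableI.
  by exists (B `&` B') => //; exact: measurableI.
- by move=> _; exists setT => //; exists setT => //; rewrite setXTT.
- by rewrite bigcup_const.
- by move=> _ [A mA [B mB <-]]; exact: m12.
Qed.

Lemma measure_preimage_pair_unique {d d1 d2} {W : measurableType d}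
    {T1 : measurableType d1} {T2 : measurableType d2} {R : realType}
    (mu nu : {measure set W -> \bar R}) (X : W -> T1) (Y : W -> T2) :
  mu setT < +oo -> measurable_fun setT X -> measurable_fun setT Y ->
  (forall A B, measurable A -> measurable B ->
    mu (X @^-1` A `&` Y @^-1` B) = nu (X @^-1` A `&` Y @^-1` B)) ->
  forall C, measurable C ->
    mu ((fun w => (X w, Y w)) @^-1` C) = nu ((fun w => (X w, Y w)) @^-1` C).
Proof.
move=> muoo mX mY munu C mC.
have mXY : measurable_fun setT (fun w => (X w, Y w)).
  exact: measurable_fun_pair.
exact: (finite_measure_rect_unique
  (m1 :=
    measure_function_pushforward__canonical__measure_function_Measure mu mXY)
  (m2 :=
    measure_function_pushforward__canonical__measure_function_Measure nu mXY)).
Qed.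

Context {d d1 d2 : measure_display} {W : measurableType d}
  {V : measurableType d2} {U : measurableType d1} {R : realType}
  (P : probability W R).

Variables (S : nat -> {RV P >-> V}) (X : nat -> {RV P >-> U})
  (g : nat -> U * V -> U) (x0 : U).
Hypotheses (iidS : iid S) (X0 : forall w, X 0%N w = x0)
  (mg : forall k, measurable_fun setT (g k))
  (Xg : forall k w, X k.+1 w = g k (X k w, S k w)).

Local Notation future J B := (\bigcap_(i in [set` J]) S i @^-1` B i).

Let measurable_future (J : {fset nat}) (B : nat -> set V) :
  (forall i, measurable (B i)) -> measurable (future J B).
Proof.
move=> mB; apply: fin_bigcap_measurable => [|i _]; first exact: finite_fset.
exact: measurable_funPTI.
Qed.

Lemma indep_future k (J : {fset nat}) (B : nat -> set V) (A : set U) :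
  (forall i, i \in J -> (k <= i)%N) -> (forall i, measurable (B i)) ->
  measurable A ->
  P (X k @^-1` A `&` future J B) = P (X k @^-1` A) * P (future J B).
Proof.
elim: k J B A => [|k IH] J B A kJ mB mA.
  have [xA|xA] := pselect (A x0).
    have -> : X 0%N @^-1` A = setT.
      by apply/seteqP; split=> // w _; rewrite /= X0.
    by rewrite setTI probability_setT mul1e.
  have -> : X 0%N @^-1` A = set0 by apply/seteqP; split=> // w; rewrite /= X0.
  by rewrite set0I measure0 mul0e.
set E := future J B; have mE : measurable E by exact: measurable_future.
have mXS : measurable_fun setT (fun w => (X k w, S k w)).
  exact: measurable_fun_pair.
pose PE := NngNum (fine_ge0 (measure_ge0 P E)).
have PEE : PE%:num%:E = P E by rewrite /= fineK// fin_num_measure.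
have -> : X k.+1 @^-1` A = (fun w => (X k w, S k w)) @^-1` (g k @^-1` A).
  by apply/seteqP; split=> w; rewrite /= Xg.
have kNJ : k \notin J by apply/negP => /kJ; rewrite ltnn.
have mgA : measurable (g k @^-1` A) by rewrite -[_ @^-1` _]setTI; exact: mg.
have kJ0 i : i \in [fset k]%fset -> (k <= i)%N by rewrite inE => /eqP ->.
have mE1 : mrestr P mE setT < +oo.
  by rewrite /mrestr setTI ltey_eq fin_num_measure.
suff mnu C D : measurable C -> measurable D ->
    mrestr P mE (X k @^-1` C `&` S k @^-1` D) =
    mscale PE P (X k @^-1` C `&` S k @^-1` D).
  have := measure_preimage_pair_unique mE1 (measurable_funP (X k))
    (measurable_funP (S k)) mnu mgA.
  by rewrite /= /mscale /mrestr PEE [in RHS]muleC.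
move=> mC mD; rewrite /= /mscale PEE /mrestr.
have fk (F : nat -> set V) : S k @^-1` F k = future [fset k]%fset F.
  by rewrite bigcap_fset big_seq_fset1.
pose B' i := if i == k then D else B i.
have mB' i : measurable (B' i) by rewrite /B'; case: ifP.
have EE : S k @^-1` D `&` E = future (k |` J)%fset B'.
  rewrite bigcap_fsetU1//; congr (_ `&` _); first by rewrite /B' eqxx.
  apply: eq_bigcapr => i iJ; rewrite /B'; case: eqP => // ik.
  by move: kNJ; rewrite -ik (iJ : i \in J).
rewrite -setIA EE IH//; last first.
  by move=> i; rewrite !inE => /orP[/eqP->//|/kJ]; exact: ltnW.
have CD : P (X k @^-1` C `&` S k @^-1` D) = P (X k @^-1` C) * P (S k @^-1` D).
  have := IH [fset k]%fset (fun=> D) C kJ0 (fun=> mD) mC.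
  by rewrite -(fk (fun=> D)).
transitivity (P E * (P (X k @^-1` C) * P (S k @^-1` D))); last by rewrite -CD.
have [indS _] := iidS.
rewrite indS// big_fsetU1//= {1}/B' eqxx muleA.
rewrite [RHS]muleC; congr (_ * _); rewrite /E indS//.
apply: eq_big_seq => i iJ; rewrite /B'; case: eqP => // ik.
by move: kNJ; rewrite -ik iJ.
Qed.

Lemma indep_current k (A : set U) (B : set V) : measurable A -> measurable B ->
  P (X k @^-1` A `&` S k @^-1` B) = P (X k @^-1` A) * P (S 0%N @^-1` B).
Proof.
move=> mA mB; have [_ /(_ k _ mB) eqd] := iidS.
have kJ i : i \in [fset k]%fset -> (k <= i)%N by rewrite inE => /eqP ->.
have := indep_future kJ (fun=> mB) mA.
by rewrite bigcap_fset big_seq_fset1 => ->; congr (_ * _).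
Qed.
End independence.

Section decoupling.
Local Open Scope ereal_scope.
Context {d d1 d2 : measure_display} {W : measurableType d}
  {T1 : measurableType d1} {T2 : measurableType d2} {R : realType}
  (P : probability W R).
Variables (X : {RV P >-> T1}) (Y Y' : {RV P >-> T2}).
Hypothesis XY : forall A B, measurable A -> measurable B ->
  P (X @^-1` A `&` Y @^-1` B) = P (X @^-1` A) * P (Y' @^-1` B).

Let mXY : measurable_fun setT (fun w => (X w, Y w)).
Proof. exact: measurable_fun_pair. Qed.

Let joint_law (C : set (T1 * T2)) : measurable C ->
  (distribution P X \x distribution P Y') C =
  pushforward P (fun w => (X w, Y w)) C.
Proof.
move=> mC; exact: (product_measure_unique (m' :=
  measure_function_pushforward__canonical__measure_function_Measure P mXY)).
Qed.

Lemma ge0_integral_decouple (f : T1 * T2 -> \bar R) :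
  measurable_fun setT f -> (forall z, 0 <= f z) ->
  \int[P]_w f (X w, Y w) = \int[P]_w \int[P]_w' f (X w, Y' w').
Proof.
move=> mf f0.
rewrite -[LHS](@ge0_integral_pushforward _ _ _ _ _ _ mXY P setT f)//.
rewrite (eq_measure_integral (distribution P X \x distribution P Y'));
  last first.
  by move=> C mC _; exact/esym/joint_law.
rewrite fubini_tonelli1//= ge0_integral_distribution//=; last 2 first.
- exact: measurable_fun_fubini_tonelli_F.
- by move=> x; apply: integral_ge0.
apply: eq_integral => w _ /=; rewrite /fubini_F ge0_integral_distribution//.
exact: measurableT_comp.
Qed.

Lemma ge0_integral_decouple_le (f : T1 * T2 -> \bar R) (C : R) :
  measurable_fun setT f -> (forall z, 0 <= f z) ->
  (forall w, \int[P]_w' f (X w, Y' w') <= C%:E) ->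
  \int[P]_w f (X w, Y w) <= C%:E.
Proof.
move=> mf f0 fC; rewrite ge0_integral_decouple//.
have -> : C%:E = \int[P]_w (cst C%:E) w.
  by rewrite integral_cst// [X in _ * X]probability_setT mule1.
apply: ge0_le_integral => //.
- by move=> w _; exact: integral_ge0.
- have -> : (fun w => \int[P]_w' f (X w, Y' w')) =
      (fubini_F (distribution P Y') f) \o X.
    apply/funext => w /=; rewrite /fubini_F ge0_integral_distribution//.
    exact: measurableT_comp.
  by apply: measurableT_comp => //; exact: measurable_fun_fubini_tonelli_F.
Qed.

Lemma le_integral_decouple (F : T1 * T2 -> R) (G : T1 -> R) :
  measurable_fun setT F ->
  P.-integrable setT (fun w => (F (X w, Y w))%:E) ->
  P.-integrable setT (fun w => (G (X w))%:E) ->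
  (forall w, P.-integrable setT (fun w' => (F (X w, Y' w'))%:E)) ->
  (forall w, \int[P]_w' (F (X w, Y' w'))%:E <= (G (X w))%:E) ->
  \int[P]_w (F (X w, Y w))%:E <= \int[P]_w (G (X w))%:E.
Proof.
move=> mF iF iG iFX FG.
have mEF : measurable_fun setT (EFin \o F) by exact/measurable_EFinP.
rewrite -[leLHS](@integral_pushforward _ _ _ _ _ _ mXY P setT (EFin \o F))//.
rewrite (eq_measure_integral (distribution P X \x distribution P Y'));
  last first.
  by move=> C mC _; exact/esym/joint_law.
have iFl : (distribution P X \x distribution P Y').-integrable setT (EFin \o F).
  apply/integrableP; split => //.
  rewrite (eq_measure_integral (pushforward P (fun w => (X w, Y w))));
    last first.
    by move=> C mC _; exact: joint_law.
  rewrite ge0_integral_pushforward//; last exact: measurableT_comp.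
  by have /integrableP[] := iF.
rewrite -integral12_prod_meas1//=.
pose H x := \int[distribution P Y']_y (F (x, y))%:E.
have mH : measurable_fun setT H by exact: (measurable_fubini_F iFl).
have iH : P.-integrable setT (H \o X).
  apply/integrableP; split; first exact: measurableT_comp.
  rewrite -(@ge0_integral_distribution _ _ _ _ _ P X (abse \o H))//=.
    by have /integrableP[] := integrable_fubini_F iFl.
  exact: measurableT_comp.
rewrite -[leLHS]/(\int[distribution P X]_x H x) integral_distribution//.
apply: le_integral => // w _ /=; rewrite /H integral_distribution//.
- exact: FG.
- exact: (measurableT_comp mEF).
- exact: iFX.

Qed.
End decoupling.

(** * One-shot decisions *)

Section frames.
Context {d : measure_display} {W : measurableType d} {R : realType}
  (P : probability W R) (m : nat).
Variables (Omega : set (m.-tuple R)) (D : m.-tuple R -> set (R * R))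
  (S : nat -> {RV P >-> m.-tuple R}) (L M : m.-tuple R -> R)
  (Tmin Tmax Rmin Rmax C1 C2 : R).
Hypothesis rs : renewal_system Omega D S L M.
Hypothesis mb : moment_bounds Omega D S Tmin Tmax Rmin Rmax C1 C2.

Section decision_law.
Local Open Scope ereal_scope.
Variable kappa : R.-pker (m.-tuple R) ~> (R * R)%type.
Hypothesis kD : decision_law Omega D kappa.

Let measurable_D s : Omega s -> measurable (D s).
Proof. by move=> Os; apply: compact_measurable_prod; exact: (D_compact rs). Qed.

Let kDC0 s : Omega s -> kappa s (~` D s) = 0.
Proof.
move=> Os; have mD := measurable_D Os.
have := @prob_kernel _ _ _ _ _ kappa s.
rewrite -(setUv (D s)) measureU//; last 2 first.
- exact: measurableC.
- by rewrite setICr.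
rewrite [X in X + _]kD// => h.
have {}h : 1%:E + kappa s (~` D s) = 1%:E := h.
have : kappa s (~` D s) \is a fin_num.
  rewrite ge0_fin_numE// (@le_lt_trans _ _ 1%:E) ?ltry//.
  by rewrite -[leRHS]h leeDr// lee_fin.
move=> /fineK xE; move: h; rewrite -xE -EFinD.
by case=> /eqP; rewrite addrC -[X in _ == X]add0r => /eqP/addIr ->.
Qed.

Lemma integrable_decision (f : R * R -> R) s (B : R) : Omega s ->
  measurable_fun setT f -> (forall z, D s z -> (`|f z| <= B)%R) ->
  (kappa s).-integrable setT (EFin \o f).
Proof.
move=> Os mf fB; have mD := measurable_D Os.
apply/(negligible_integrable _ _ _ (kDC0 Os)) => //.
- exact: measurableC.
- exact/measurable_EFinP.
rewrite setTD setCK; apply: measurable_bounded_integrable => //.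
- by rewrite kD// ltry.
- exact: measurable_funTS.
exists B; split; first exact: num_real.
by move=> x Bx z Dz; apply: le_trans (fB z Dz) _; exact: ltW.
Qed.

Lemma integral_decision_le (f : R * R -> R) s (B C : R) : Omega s ->
  measurable_fun setT f -> (forall z, D s z -> (`|f z| <= B)%R) ->
  (forall z, D s z -> (f z <= C)%R) ->
  \int[kappa s]_z (f z)%:E <= C%:E.
Proof.
move=> Os mf fB fC; have mD := measurable_D Os.
have fi := integrable_decision Os mf fB.
rewrite (negligible_integral (measurableC mD) measurableT fi (kDC0 Os)).
rewrite setTD setCK.
have -> : C%:E = \int[kappa s]_(z in D s) (cst C%:E) z.
  by rewrite integral_cst// [X in _ * X]kD// mule1.
apply: le_integral => //.
- exact: integrableS fi.
- apply/integrableP; split; first exact: measurable_cst.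
  rewrite integral_cst// [X in _ * X]kD// mule1 ltry//.
- by move=> z /set_mem Dz; rewrite /= lee_fin fC.
Qed.

Lemma measurable_decision_mean (f : R * R -> R) : measurable_fun setT f ->
  measurable_fun setT (fun s => \int[kappa s]_z (f z)%:E).
Proof.
move=> mf; under eq_fun do rewrite integralE.
have mEf : measurable_fun setT (EFin \o f) by exact/measurable_EFinP.
apply: emeasurable_funB; apply: measurable_fun_integral_kernel => //.
- exact: measurable_kernel.
- exact: measurable_funepos.
- exact: measurable_kernel.
- exact: measurable_funeneg.
Qed.

End decision_law.

Section achievable_bound.
Variable h : m.-tuple R -> R.
Variable th : R.
Hypothesis h_int : P.-integrable setT (EFin \o h \o S 0%N).
Hypothesis h_max : forall s z, Omega s -> D s z -> z.2 - th * z.1 <= h s.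

Let coord_le_M s z : Omega s -> D s z -> `|z.1| <= M s + 1 /\ `|z.2| <= M s + 1.
Proof.
move=> Os Dz; have zM := D_leM rs Os Dz.
have sq (x : R) : `|x| <= x ^+ 2 + 1.
  rewrite -real_normK ?num_real//; have := sqr_ge0 (`|x| - 2^-1); lra.
have := sq z.1; have := sq z.2; have := sqr_ge0 z.1; have := sqr_ge0 z.2.
by split; lra.
Qed.

Lemma achievable_le (x : R * R) : achievable Omega D S x ->
  x.2 - th * x.1 <= fine (\int[P]_w (h (S 0%N w))%:E).
Proof.
move=> [kappa kD [x1 x2]].
have mfst : measurable_fun setT (fst : R * R -> R) by exact: measurable_fst.
have msnd : measurable_fun setT (snd : R * R -> R) by exact: measurable_snd.
pose E1 s := (\int[kappa s]_z (z.1)%:E)%E.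
pose E2 s := (\int[kappa s]_z (z.2)%:E)%E.
have xE1 : (\int[P]_w (E1 \o S 0%N) w = x.1%:E)%E by rewrite x1.
have xE2 : (\int[P]_w (E2 \o S 0%N) w = x.2%:E)%E by rewrite x2.
have iE1 : P.-integrable setT (E1 \o S 0%N).
  apply: fin_num_integrable.
    exact: measurableT_comp (measurable_decision_mean kappa mfst) _.
  by rewrite xE1.
have iE2 : P.-integrable setT (E2 \o S 0%N).
  apply: fin_num_integrable.
    exact: measurableT_comp (measurable_decision_mean kappa msnd) _.
  by rewrite xE2.
have Eh s : Omega s -> (E2 s - th%:E * E1 s <= (h s)%:E)%E.
  move=> Os.
  have b1 z : D s z -> `|z.1| <= M s + 1 by case/(coord_le_M Os).
  have b2 z : D s z -> `|z.2| <= M s + 1 by case/(coord_le_M Os).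
  have i1 := integrable_decision kD Os mfst b1.
  have i2 := integrable_decision kD Os msnd b2.
  rewrite /E1 -integralZl// -integralB//=; last exact: integrableZl.
  rewrite (eq_integral (fun z : R * R => (z.2 - th * z.1)%:E)); last first.
    by move=> z _; rewrite EFinB EFinM.
  apply: (integral_decision_le kD (f := fun z => z.2 - th * z.1)
    (B := M s + 1 + `|th| * (M s + 1))) => //.
  - by apply: measurable_funB => //; exact: measurable_funM.
  - move=> z Dz; rewrite (le_trans (ler_normB _ _))// normrM lerD ?b2//.
    by rewrite ler_wpM2l ?b1.
  - by move=> z; exact: h_max.
have -> : x.2 - th * x.1 =
    fine (\int[P]_w (E2 (S 0%N w) - th%:E * E1 (S 0%N w)))%E.
  rewrite integralB//=; last exact: integrableZl.
  by rewrite integralZl// xE1 xE2.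
have iE : P.-integrable setT (fun w => E2 (S 0%N w) - th%:E * E1 (S 0%N w))%E.
  exact: (integrableB measurableT iE2 (integrableZl measurableT th iE1)).
apply: fine_le.
- exact: integrable_fin_num.
- exact: integrable_fin_num.
- apply: le_integral => //.
  by move=> w _; apply: Eh; exact: state_in rs 0%N w.
Qed.

Lemma closure_achievable_le (x : R * R) : closure (achievable Omega D S) x ->
  x.2 - th * x.1 <= fine (\int[P]_w (h (S 0%N w))%:E).
Proof.
set C := fine _.
have cl : closed [set x : R * R | x.2 - th * x.1 <= C].
  apply: (closed_comp (f := fun x : R * R => x.2 - th * x.1)
    (D := [set t | t <= C])); last exact: closed_le.
  move=> z _; apply: cvgB; first exact: cvg_snd.
  by apply: cvgM; [exact: cvg_cst|exact: cvg_fst].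
by move=> /(closure_subset achievable_le); rewrite -((closure_id _).1 cl).
Qed.
End achievable_bound.

Section policy.
Variable p : m.-tuple R -> R * R.
Hypotheses (mp : measurable_fun setT p)
  (pD : forall s, Omega s -> D s (p s)).

Lemma decision_law_kdirac : decision_law Omega D (kdirac mp).
Proof.
move=> s Os; transitivity (\d_(p s) (D s) : \bar R); first by [].
by rewrite diracE mem_set//; exact: pD.
Qed.

Lemma frame_mean_kdirac (f : R * R -> R) : measurable_fun setT f ->
  frame_mean S 0 (kdirac mp) f = (\int[P]_w (f (p (S 0%N w)))%:E)%E.
Proof.
move=> mf; apply: eq_integral => w _; rewrite integral_dirac//.
  by rewrite diracT mul1e.
exact/measurable_EFinP.
Qed.

Let mfst : measurable_fun setT (fst : R * R -> R).
Proof. exact: measurable_fst. Qed.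

Let msnd : measurable_fun setT (snd : R * R -> R).
Proof. exact: measurable_snd. Qed.

Let fin_num_between (a b : R) (x : \bar R) :
  (a%:E <= x <= b%:E)%E -> x \is a fin_num.
Proof. by case: x => [x| |]//=; rewrite ?leye_eq ?leeNy_eq ?andbF. Qed.

Lemma policy_integrable1 : P.-integrable setT (fun w => (p (S 0%N w)).1%:E).
Proof.
apply: fin_num_integrable.
  by apply/measurable_EFinP; do 2 apply: measurableT_comp => //.
have := T_bounds mb 0 decision_law_kdirac.
by rewrite frame_mean_kdirac// => /fin_num_between.
Qed.

Lemma policy_integrable2 : P.-integrable setT (fun w => (p (S 0%N w)).2%:E).
Proof.
apply: fin_num_integrable.
  by apply/measurable_EFinP; do 2 apply: measurableT_comp => //.
have := R_bounds mb 0 decision_law_kdirac.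
by rewrite frame_mean_kdirac// => /fin_num_between.
Qed.

Lemma policy_second_moment1 :
  (\int[P]_w ((p (S 0%N w)).1 ^+ 2)%:E <= C1%:E)%E.
Proof.
rewrite -(frame_mean_kdirac (f := fun z => z.1 ^+ 2)).
  exact: (T2_bound mb 0 decision_law_kdirac).
exact: measurable_funX.
Qed.

Lemma policy_second_moment2 :
  (\int[P]_w ((p (S 0%N w)).2 ^+ 2)%:E <= C2%:E)%E.
Proof.
rewrite -(frame_mean_kdirac (f := fun z => z.2 ^+ 2)).
  exact: (R2_bound mb 0 decision_law_kdirac).
exact: measurable_funX.
Qed.

Lemma policy_achievable : achievable Omega D S
  (\int[P]_w (p (S 0%N w)).1, \int[P]_w (p (S 0%N w)).2).
Proof.
exists (kdirac mp); first exact: decision_law_kdirac.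
by split; rewrite frame_mean_kdirac//= fineK// integrable_fin_num//;
  [exact: policy_integrable1|exact: policy_integrable2].
Qed.
End policy.

Lemma achievable_ge_Tmin (x : R * R) : achievable Omega D S x -> Tmin <= x.1.
Proof.
move=> [kappa kD [x1 _]]; have := T_bounds mb 0 kD.
by rewrite -x1 lee_fin => /andP[].
Qed.

Lemma closure_achievable_ge_Tmin (x : R * R) :
  closure (achievable Omega D S) x -> Tmin <= x.1.
Proof.
have cl : closed [set x : R * R | Tmin <= x.1].
  apply: (closed_comp (f := fun x : R * R => x.1) (D := [set t | Tmin <= t])).
    by move=> z _; exact: cvg_fst.
  exact: closed_ge.
by move=> /(closure_subset achievable_ge_Tmin); rewrite -((closure_id _).1 cl).
Qed.
End frames.

(** * The adaptive run *)

Lemma proj_itv_in {R : realType} (a b x : R) :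
  a <= b -> a <= proj_itv a b x <= b.
Proof.
by move=> ab; rewrite /proj_itv le_max lexx/= ge_max ab ge_min lexx orbT.
Qed.

Lemma proj_itv_contract {R : realType} (a b x y : R) : a <= y <= b ->
  (proj_itv a b x - y) ^+ 2 <= (x - y) ^+ 2.
Proof.
move=> /andP[ay yb]; rewrite /proj_itv; have ab := le_trans ay yb.
case: (leP x b) => [xb|bx]; last by rewrite max_r//; nra.
by case: (leP a x) => ax //; nra.
Qed.

Lemma integrable_second_moment {d} {W : measurableType d} {R : realType}
    (P : probability W R) (X : {RV P >-> R}) (C : R) :
  (\int[P]_w ((X w) ^+ 2)%:E <= C%:E)%E -> P.-integrable setT (EFin \o X).
Proof.
move=> XC; have mX : measurable_fun setT X by [].
have iX2 : P.-integrable setT (fun w => ((X w) ^+ 2)%:E).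
  apply/integrableP; split.
    by apply/measurable_EFinP; exact: measurable_funX.
  under eq_integral do rewrite gee0_abs ?lee_fin ?sqr_ge0//.
  by rewrite (le_lt_trans XC)// ltry.
have i1 := integrableD measurableT iX2
  (finite_measure_integrable_cst P 1 measurableT).
apply: (le_integrable measurableT _ _ i1); first exact/measurable_EFinP.
move=> w _; rewrite /= lee_fin [leRHS]ger0_norm ?addr_ge0 ?sqr_ge0//.
rewrite -(real_normK (num_real (X w))); have := sqr_ge0 (`|X w| - 2^-1); lra.
Qed.

Lemma curvature_gap {R : realType} 
  (c Tm thstar tstar rstar th t r : R) : 0 < c ->
  Tm <= tstar -> Tm <= t -> rstar = thstar * tstar ->
  r <= rstar + thstar * (t - tstar) - c / 2 * (t - tstar) ^+ 2 ->
  rstar - th * tstar <= r - th * t ->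
  [/\ r <= thstar * t,
      thstar * t - r <= 2 / c * (th - thstar) ^+ 2 &
      (th - thstar) * (r - th * t) <= - Tm * (th - thstar) ^+ 2].
Proof.
move=> c0 Ts Tt rsE rc rm; set u := t - tstar in rc.
have u0 : 0 <= c / 2 * u ^+ 2 by rewrite mulr_ge0 ?sqr_ge0// divr_ge0// ltW.
have tE : t = u + tstar by rewrite /u; ring.
have rt : r <= thstar * t - c / 2 * u ^+ 2 by move: rc; rewrite rsE tE; lra.
set e := th - thstar; have thE : th = thstar + e by rewrite /e; ring.
have eu : thstar * t - r <= - e * u.
  by move: rm; rewrite rsE thE tE; lra.
split; first lra.
- apply: (le_trans eu).
  have h : c / 2 * u ^+ 2 <= - e * u by lra.
  have := sqr_ge0 (2 * e + c * u).
  have := ler_wpM2l (ltW c0) h.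
  rewrite (_ : 2 / c * e ^+ 2 = 2 * e ^+ 2 / c) ?ler_pdivlMr//; last by ring.
  by move: (e) (u) (c) => e' u' c'; lra.
- rewrite thE; have [e0|e0] := leP 0 e.
  + have : r - (thstar + e) * t <= - Tm * e by nra.
    nra.
  + have : - Tm * e <= r - (thstar + e) * t by nra.
    nra.
Qed.

Section run.
Context {d : measure_display} {W : measurableType d} {R : realType}
  (P : probability W R) (m : nat).
Variables (Omega : set (m.-tuple R)) (D : m.-tuple R -> set (R * R))
  (S : nat -> {RV P >-> m.-tuple R}) (L M : m.-tuple R -> R)
  (Tmin Tmax Rmin Rmax C1 C2 thmin thmax theta0 : R) (eta : nat -> R)
  (phi : nat -> R * m.-tuple R -> R * R) (T Rw theta : nat -> {RV P >-> R}).
Hypothesis rs : renewal_system Omega D S L M.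
Hypothesis mb : moment_bounds Omega D S Tmin Tmax Rmin Rmax C1 C2.
Hypothesis th0 : thmin <= theta0 <= thmax.
Hypothesis run : adaptive_run Omega D S thmin thmax theta0 eta phi T Rw theta.

Lemma theta_in k w : thmin <= theta k w <= thmax.
Proof.
case: k => [|k]; first by rewrite (run_init run).
by rewrite (run_update run) proj_itv_in//; case/andP: th0 => /le_trans; apply.
Qed.

Lemma duration_rule k w : T k w = (phi k (theta k w, S k w)).1.
Proof. by rewrite -(run_decision run). Qed.

Lemma reward_rule k w : Rw k w = (phi k (theta k w, S k w)).2.
Proof. by rewrite -(run_decision run). Qed.

Lemma measurable_rule k : measurable_fun setT (phi k).
Proof. by have [] := run_rule run k. Qed.

Lemma measurable_rule1 k : measurable_fun setT (fun x => (phi k x).1).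
Proof. by apply: measurableT_comp => //; exact: measurable_rule. Qed.

Lemma measurable_rule2 k : measurable_fun setT (fun x => (phi k x).2).
Proof. by apply: measurableT_comp => //; exact: measurable_rule. Qed.

Lemma measurable_rule_at k th : measurable_fun setT (fun s => phi k (th, s)).
Proof.
by apply: measurableT_comp (measurable_rule k) _ => //; exact: measurable_pair1.
Qed.

Lemma rule_in_D k th : thmin <= th <= thmax ->
  forall s, Omega s -> D s (phi k (th, s)).
Proof. by move=> thI s Os; have [_ /(_ th s thI Os)[]] := run_rule run k. Qed.

Lemma theta_state_indep k (A : set R) (B : set (m.-tuple R)) :
  measurable A -> measurable B ->
  (P (theta k @^-1` A `&` S k @^-1` B) =
   P (theta k @^-1` A) * P (S 0%N @^-1` B))%E.
Proof.
pose g k (x : R * m.-tuple R) := proj_itv thmin thmax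
  (x.1 + eta k * ((phi k x).2 - x.1 * (phi k x).1)).
apply: (@indep_current _ _ _ _ _ _ _ _ S theta g theta0).
- exact: state_iid rs.
- exact: run_init run.
- move=> j; apply: measurable_maxr => //; apply: measurable_minr => //.
  apply: measurable_funD => //; apply: measurable_funM => //.
  apply: measurable_funB; first exact: measurable_rule2.
  by apply: measurable_funM => //; exact: measurable_rule1.
- by move=> j w; rewrite (run_update run) duration_rule reward_rule.
Qed.

Lemma duration_second_moment k : (\int[P]_w ((T k w) ^+ 2)%:E <= C1%:E)%E.
Proof.
pose f (x : R * m.-tuple R) : \bar R := ((phi k x).1 ^+ 2)%:E.
have -> : (\int[P]_w ((T k w) ^+ 2)%:E = \int[P]_w f (theta k w, S k w))%E.
  by apply: eq_integral => w _; rewrite duration_rule.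
apply: (ge0_integral_decouple_le (theta_state_indep k)) => //.
- by apply/measurable_EFinP; apply: measurable_funX; exact: measurable_rule1.
- by move=> z; rewrite lee_fin sqr_ge0.
- move=> w.
  apply: (policy_second_moment1 mb (p := fun s => phi k (theta k w, s))).
    exact: measurable_rule_at.
  exact/rule_in_D/theta_in.
Qed.

Lemma reward_second_moment k : (\int[P]_w ((Rw k w) ^+ 2)%:E <= C2%:E)%E.
Proof.
pose f (x : R * m.-tuple R) : \bar R := ((phi k x).2 ^+ 2)%:E.
have -> : (\int[P]_w ((Rw k w) ^+ 2)%:E = \int[P]_w f (theta k w, S k w))%E.
  by apply: eq_integral => w _; rewrite reward_rule.
apply: (ge0_integral_decouple_le (theta_state_indep k)) => //.
- by apply/measurable_EFinP; apply: measurable_funX; exact: measurable_rule2.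
- by move=> z; rewrite lee_fin sqr_ge0.
- move=> w.
  apply: (policy_second_moment2 mb (p := fun s => phi k (theta k w, s))).
    exact: measurable_rule_at.
  exact/rule_in_D/theta_in.
Qed.

Lemma integrable_duration k : P.-integrable setT (EFin \o T k).
Proof. exact: integrable_second_moment (duration_second_moment k). Qed.

Lemma integrable_reward k : P.-integrable setT (EFin \o Rw k).
Proof. exact: integrable_second_moment (reward_second_moment k). Qed.

Lemma integrable_theta_mul k (a : R -> R) (Y : {RV P >-> R}) : continuous a ->
  P.-integrable setT (EFin \o Y) ->
  P.-integrable setT (fun w => (a (theta k w) * Y w)%:E).
Proof.
move=> ca iY; have mat : measurable_fun setT (a \o theta k).
  by apply: measurableT_comp => //; exact: continuous_measurable_fun.
have ba : [bounded (a \o theta k) w | w in setT].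
  have := @continuous_compact _ _ a `[thmin, thmax]%classic
    (continuous_subspaceT ca) (@segment_compact _ thmin thmax).
  move=> /compact_bounded[B [Br Ba]]; exists B; split => // x Bx w _.
  by apply: Ba Bx _ _; exists (theta k w) => //=; rewrite in_itv/= theta_in.
exact: (integrableMr measurableT mat ba iY).
Qed.

Lemma integrable_theta k (a : R -> R) : continuous a ->
  P.-integrable setT (fun w => (a (theta k w))%:E).
Proof.
move=> ca; have i1 := finite_measure_integrable_cst P 1 measurableT.
have := integrable_theta_mul k ca (Y := cst 1) i1.
by under eq_fun do rewrite mulr1.
Qed.

(* Given theta k = th, frame k is a one-shot decision by phi k (th, -). *)
Lemma run_mean_le k (a b G : R -> R) :
  continuous a -> continuous b -> continuous G ->
  (forall th, thmin <= th <= thmax ->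
    a th * \int[P]_w (phi k (th, S 0%N w)).2 +
    b th * \int[P]_w (phi k (th, S 0%N w)).1 <= G th) ->
  \int[P]_w (a (theta k w) * Rw k w + b (theta k w) * T k w) <=
  \int[P]_w G (theta k w).
Proof.
move=> ca cb cG abG.
have ma := continuous_measurable_fun ca.
have mb' := continuous_measurable_fun cb.
pose F (x : R * m.-tuple R) := a x.1 * (phi k x).2 + b x.1 * (phi k x).1.
have iF : P.-integrable setT (fun w => (F (theta k w, S k w))%:E).
  under eq_fun do rewrite /F -reward_rule -duration_rule/= EFinD.
  exact: (integrableD measurableT
    (integrable_theta_mul k ca (integrable_reward k))
    (integrable_theta_mul k cb (integrable_duration k))).
have i1 w := policy_integrable1 mb (measurable_rule_at k (theta k w))
  (rule_in_D k (theta_in k w)).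
have i2 w := policy_integrable2 mb (measurable_rule_at k (theta k w))
  (rule_in_D k (theta_in k w)).
have iG := integrable_theta k cG.
have -> : \int[P]_w (a (theta k w) * Rw k w + b (theta k w) * T k w) =
    \int[P]_w F (theta k w, S k w).
  by apply: eq_Rintegral => w _; rewrite /F reward_rule duration_rule.
have iFw w : P.-integrable setT (fun w' => (F (theta k w, S 0%N w'))%:E).
  under eq_fun do rewrite /F EFinD !EFinM.
  exact: (integrableD measurableT
    (integrableZl measurableT (a (theta k w)) (i2 w))
    (integrableZl measurableT (b (theta k w)) (i1 w))).
apply: fine_le; [exact: integrable_fin_num|exact: integrable_fin_num|].
apply: (le_integral_decouple (theta_state_indep k)) => //.
  apply: measurable_funD; apply: measurable_funM => //.
  - exact: measurableT_comp ma _.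
  - exact: measurable_rule2.
  - exact: measurableT_comp mb' _.
  - exact: measurable_rule1.
move=> w; rewrite -[leLHS]fineK; last exact: integrable_fin_num.
rewrite lee_fin; apply: le_trans (abG _ (theta_in k w)).
rewrite -(RintegralZl (a (theta k w)) measurableT (i2 w)).
rewrite -(RintegralZl (b (theta k w)) measurableT (i1 w)).
rewrite -(RintegralD measurableT
  (f1 := fun w' => a (theta k w) * (phi k (theta k w, S 0%N w')).2)
  (f2 := fun w' => b (theta k w) * (phi k (theta k w, S 0%N w')).1))//.
- exact: (integrableZl measurableT (a (theta k w)) (i2 w)).
- exact: (integrableZl measurableT (b (theta k w)) (i1 w)).
Qed.

Variables (c thstar tstar rstar : R).
Hypotheses (c0 : 0 < c) (thsI : thmin <= thstar <= thmax)
  (star : closure (achievable Omega D S) (tstar, rstar))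
  (ths : thstar = rstar / tstar)
  (curv : forall t r : R, closure (achievable Omega D S) (t, r) ->
     r <= rstar + thstar * (t - tstar) - c / 2 * (t - tstar) ^+ 2).

Lemma rule_gap k th : thmin <= th <= thmax ->
  let t := \int[P]_w (phi k (th, S 0%N w)).1 in
  let r := \int[P]_w (phi k (th, S 0%N w)).2 in
  Tmin <= t /\ [/\ r <= thstar * t,
      thstar * t - r <= 2 / c * (th - thstar) ^+ 2 &
      (th - thstar) * (r - th * t) <= - Tmin * (th - thstar) ^+ 2].
Proof.
move=> thI t r; have mp := measurable_rule_at k th; have pD := rule_in_D k thI.
have i1 := policy_integrable1 mb mp pD; have i2 := policy_integrable2 mb mp pD.
have ach : achievable Omega D S (t, r) := policy_achievable mb mp pD.
have Tt : Tmin <= t := achievable_ge_Tmin mb ach.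
have Ts : Tmin <= tstar := closure_achievable_ge_Tmin mb star.
have ts0 : tstar != 0 by have := Tmin_gt0 mb; lra.
split => //; apply: (@curvature_gap R c Tmin thstar tstar rstar) => //.
- by rewrite ths divfK.
- by apply: curv; exact: subset_closure.
have iq : P.-integrable setT
    (fun w => ((phi k (th, S 0%N w)).2%:E -
      th%:E * (phi k (th, S 0%N w)).1%:E)%E).
  exact: (integrableB measurableT i2 (integrableZl measurableT th i1)).
have -> : r - th * t =
    \int[P]_w ((phi k (th, S 0%N w)).2 - th * (phi k (th, S 0%N w)).1).
  rewrite /r /t -RintegralZl// -RintegralB//.
  exact: (integrableZl measurableT th i1).
apply: (closure_achievable_le rs _ _ star
  (h := fun s => (phi k (th, s)).2 - th * (phi k (th, s)).1)) => // s z Os Dz.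
by have [_ /(_ th s thI Os)[_]] := run_rule run k; apply.
Qed.

Local Notation tau k := (\int[P]_w T k w).
Local Notation rho k := (\int[P]_w Rw k w).
Local Notation zeta k := (\int[P]_w (theta k w - thstar) ^+ 2).

Let continuous_cst (x : R) : continuous (fun _ : R => x).
Proof. exact: cst_continuous. Qed.

Let continuous_dev : continuous (fun x : R => x - thstar).
Proof. by move=> x; apply: cvgB => //; exact: cvg_cst. Qed.

Let continuous_sqdev (y : R) : continuous (fun x : R => y * (x - thstar) ^+ 2).
Proof.
move=> x; apply: cvgM; first exact: cvg_cst.
by rewrite expr2; apply: cvgM; exact: continuous_dev.
Qed.

Let mean_cst (x : R) : \int[P]_w x = x.
Proof. by rewrite Rintegral_cst// [X in fine X]probability_setT mulr1. Qed.

Lemma mean_duration_ge k : Tmin <= tau k.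
Proof.
have := @run_mean_le k (fun=> 0) (fun=> -1) (fun=> - Tmin)
  (@continuous_cst _) (@continuous_cst _) (@continuous_cst _).
under eq_Rintegral do rewrite mul0r add0r.
rewrite RintegralZl//; last exact: integrable_duration.
rewrite mean_cst mulN1r lerN2; apply.
by move=> th /(rule_gap k)[? _]; rewrite mul0r add0r mulN1r lerN2.
Qed.

Lemma mean_gap_ge0 k : rho k <= thstar * tau k.
Proof.
have := @run_mean_le k (fun=> 1) (fun=> - thstar) (fun=> 0)
  (@continuous_cst _) (@continuous_cst _) (@continuous_cst _).
have iT := integrable_duration k; have iR := integrable_reward k.
under eq_Rintegral do rewrite mul1r mulNr.
rewrite RintegralB//; last exact: (integrableZl measurableT _ iT).
rewrite RintegralZl// mean_cst subr_le0; apply.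
by move=> th /(rule_gap k)[_ [? _ _]]; rewrite mul1r mulNr subr_le0.
Qed.

Lemma mean_gap_le k : thstar * tau k - rho k <= 2 / c * zeta k.
Proof.
have := @run_mean_le k (fun=> -1) (fun=> thstar)
  (fun x => 2 / c * (x - thstar) ^+ 2)
  (@continuous_cst _) (@continuous_cst _) (@continuous_sqdev _).
have iT := integrable_duration k; have iR := integrable_reward k.
under eq_Rintegral do rewrite mulN1r addrC.
rewrite RintegralB//; last exact: (integrableZl measurableT _ iT).
rewrite !RintegralZl//; last first.
  have := integrable_theta k (@continuous_sqdev 1).
  by under eq_fun do rewrite mul1r.
apply => th /(rule_gap k)[_ [_ ? _]]; lra.
Qed.

Lemma mean_drift k :
  \int[P]_w ((theta k w - thstar) * (Rw k w - theta k w * T k w)) <=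
  - Tmin * zeta k.
Proof.
have cb : continuous (fun x : R => - (x - thstar) * x).
  by move=> x; apply: cvgM => //; apply: cvgN; exact: continuous_dev.
have := @run_mean_le k (fun x => x - thstar) (fun x => - (x - thstar) * x)
  (fun x => - Tmin * (x - thstar) ^+ 2) continuous_dev cb (@continuous_sqdev _).
under eq_Rintegral do rewrite -mulrA mulNr -mulrBr.
rewrite RintegralZl//; last first.
  have := integrable_theta k (@continuous_sqdev 1).
  by under eq_fun do rewrite mul1r.
apply => th /(rule_gap k)[_ [_ _ ?]]; lra.
Qed.

Lemma mean_sqdev_rec k (b : R) : 0 <= eta k ->
  (2^-1%:E * 'E_P[fun w => ((Rw k w - theta k w * T k w) ^+ 2)%R] <= b%:E)%E ->
  zeta k.+1 <= (1 - 2 * eta k * Tmin) * zeta k + 2 * eta k ^+ 2 * b.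
Proof.
move=> eta0; rewrite unlock; set E := (\int[P]_w _)%E => Eb.
have E0 : (0 <= E)%E by apply: integral_ge0 => w _; rewrite lee_fin sqr_ge0.
have Efin : E \is a fin_num.
  rewrite ge0_fin_numE// ltey; apply/eqP => Eoo; move: Eb.
  by rewrite Eoo gt0_muley ?lte_fin ?invr_gt0// leye_eq.
have {}Eb : fine E <= 2 * b.
  by move: Eb; rewrite -(fineK Efin) -EFinM lee_fin /=; lra.
have iT := integrable_duration k; have iR := integrable_reward k.
pose De w := Rw k w - theta k w * T k w.
have mDe : measurable_fun setT De.
  by apply: measurable_funB => //; exact: measurable_funM.
have iD2 : P.-integrable setT (fun w => (De w ^+ 2)%:E).
  apply: fin_num_integrable => //.
  by apply/measurable_EFinP; exact: measurable_funX.
have isq j : P.-integrable setT (fun w => ((theta j w - thstar) ^+ 2)%:E).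
  have := integrable_theta j (@continuous_sqdev 1).
  by under eq_fun do rewrite mul1r.
have iX : P.-integrable setT (fun w => ((theta k w - thstar) * De w)%:E).
  have cb : continuous (fun x : R => (x - thstar) * x).
    by move=> x; apply: cvgM => //; exact: continuous_dev.
  under eq_fun do rewrite /De mulrBr mulrA EFinB.
  exact: (integrableB measurableT (integrable_theta_mul k continuous_dev iR)
    (integrable_theta_mul k cb iT)).
have i2 : P.-integrable setT
    (fun w => (2 * eta k * ((theta k w - thstar) * De w))%:E).
  exact: (integrableZl measurableT (2 * eta k) iX).
have i3 : P.-integrable setT (fun w => (eta k ^+ 2 * De w ^+ 2)%:E).
  exact: (integrableZl measurableT (eta k ^+ 2) iD2).
have i12 : P.-integrable setT (fun w =>
    ((theta k w - thstar) ^+ 2 + 2 * eta k * ((theta k w - thstar) * De w))%:E).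
  exact: (integrableD measurableT (isq k) i2).
have i123 : P.-integrable setT (fun w => ((theta k w - thstar) ^+ 2 +
    2 * eta k * ((theta k w - thstar) * De w) + eta k ^+ 2 * De w ^+ 2)%:E).
  exact: (integrableD measurableT i12 i3).
have step : zeta k.+1 <= \int[P]_w ((theta k w - thstar) ^+ 2 +
    2 * eta k * ((theta k w - thstar) * De w) + eta k ^+ 2 * De w ^+ 2).
  apply: le_Rintegral => // [|w _]; first exact: isq.
  rewrite (run_update run).
  by apply: le_trans (proj_itv_contract _ thsI) _; rewrite -/(De w); lra.
apply: le_trans step _.
rewrite (RintegralD measurableT i12 i3) (RintegralD measurableT (isq k) i2).
rewrite (RintegralZl _ measurableT iX) (RintegralZl _ measurableT iD2).
have := mean_drift k; rewrite -/De => drift.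
have -> : \int[P]_w De w ^+ 2 = fine E by [].
have := ler_wpM2l (mulr_ge0 (ler0n _ 2) eta0) drift.
have := ler_wpM2l (sqr_ge0 (eta k)) Eb.
lra.
Qed.
End run.

(** * Real sequences *)

Lemma sqdev_decay {R : realType} (z : nat -> R) (beta : R) : 0 <= beta ->
  (forall k, z k.+1 <= (1 - 2 / (k + 2)%:R) * z k + beta / (k + 2)%:R ^+ 2) ->
  forall k, z k.+1 <= beta / k.+1%:R.
Proof.
move=> b0 zrec; elim=> [|k IH]; apply: le_trans (zrec _) _.
  by rewrite divff ?pnatr_eq0// subrr mul0r add0r divr1 ler_pdivrMr; nra.
set x : R := k.+1%:R in IH *; have x1 : 1 <= x by rewrite ler1n.
have -> : (k.+1 + 2)%:R = x + 2 by rewrite natrD.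
have -> : k.+2%:R = x + 1 by rewrite -addn1 natrD.
have x0 : 0 < x by lra. have x2 : 0 < x + 2 by lra.
have e : (1 - 2 / (x + 2)) = x / (x + 2) by field; lra.
have : x / (x + 2) * z k.+1 <= beta / (x + 2).
  rewrite mulrAC ler_pM2r ?invr_gt0// -ler_pdivlMl// mulrC; exact: IH.
rewrite e => h.
suff : beta / (x + 2) + beta / (x + 2) ^+ 2 <= beta / (x + 1) by lra.
rewrite -mulrDr ler_wpM2l//.
rewrite (_ : _ + _ = (x + 3) / (x + 2) ^+ 2); last by field; lra.
rewrite ler_pdivrMr ?exprn_gt0// mulrC ler_pdivlMr; nra.
Qed.

Lemma invr_le_ln_diff {R : realType} (n : nat) :
  n.+2%:R^-1 <= ln n.+2%:R - ln n.+1%:R :> R.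
Proof.
have p1 : (0 : R) < n.+1%:R by rewrite ltr0n.
have p2 : (0 : R) < n.+2%:R by rewrite ltr0n.
rewrite -ln_div ?posrE//.
rewrite -[leLHS]opprK -[leRHS]opprK lerN2 -lnV ?posrE ?divr_gt0//.
have -> : (n.+2%:R / n.+1%:R)^-1 = 1 + - n.+2%:R^-1 :> R.
  have -> : n.+2%:R = n.+1%:R + 1 :> R by rewrite -addn1 natrD.
  by field; lra.
by apply: le_ln1Dx; rewrite ltrN2 invf_lt1// ltr1n.
Qed.

Lemma sum_sqdev_le {R : realType} (z : nat -> R) (beta : R) : 0 <= beta ->
  (forall k, z k.+1 <= beta / k.+1%:R) ->
  forall n, \sum_(0 <= k < n.+2) z k <= z 0%N + beta * (1 + ln n.+1%:R).
Proof.
move=> b0 zb; elim=> [|n IH].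
  rewrite !big_nat_recr//= big_nil add0r ln1 addr0 mulr1 lerD2l.
  by have := zb 0%N; rewrite divr1.
rewrite big_nat_recr//=; apply: le_trans (lerD IH (zb n.+1)) _.
rewrite -addrA lerD2l -mulrDr ler_wpM2l//.
by rewrite -addrA lerD2l -lerBrDl; exact: invr_le_ln_diff.
Qed.

Lemma ratio_gap {R : realType} (t r z : nat -> R) (Tm th a B : R) n :
  0 < Tm -> 0 <= a -> (forall k, Tm <= t k) -> (forall k, r k <= th * t k) ->
  (forall k, th * t k - r k <= a * z k) -> (0 < n)%N ->
  \sum_(0 <= k < n) z k <= B ->
  `|th - (\sum_(0 <= k < n) r k) / (\sum_(0 <= k < n) t k)|
     <= a * B / (n%:R * Tm).
Proof.
move=> Tm0 a0 Tt rt gap n0 zB.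
have n0' : (0 : R) < n%:R by rewrite ltr0n.
set st := \sum_(0 <= k < n) t k; set sr := \sum_(0 <= k < n) r k.
have st_ge : n%:R * Tm <= st.
  rewrite /st -[X in X%:R * _]subn0 mulr_natl -sumr_const_nat.
  exact: ler_sum.
have nT0 : 0 < n%:R * Tm by rewrite mulr_gt0.
have st0 : 0 < st by exact: lt_le_trans st_ge.
have -> : th - sr / st = (th * st - sr) / st by field; lra.
have gE : th * st - sr = \sum_(0 <= k < n) (th * t k - r k).
  by rewrite sumrB -mulr_sumr.
have g0 : 0 <= th * st - sr by rewrite gE sumr_ge0// => k _; rewrite subr_ge0.
have gB : th * st - sr <= a * B.
  apply: (@le_trans _ _ (a * \sum_(0 <= k < n) z k)); last exact: ler_wpM2l.
  by rewrite gE mulr_sumr; exact: ler_sum.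
rewrite ger0_norm ?divr_ge0 ?(ltW st0)//.
apply: ler_pM => //; first by rewrite invr_ge0 ltW.
by rewrite lef_pV2 ?posrE.
Qed.

Lemma eqO_ln_div {R : realType} (f : nat -> R) (A B C : R) :
  0 <= A -> 0 <= B -> 0 < C ->
  (forall K, (2 <= K)%N ->
    `|f K| <= (A + B * (1 + ln (K - 1)%:R)) / (K%:R * C)) ->
  (f : nat -> R^o) =O_\oo (fun K => ln K%:R / K%:R : R^o).
Proof.
move=> A0 B0 C0 fAB; apply/eqO_exP.
have l2 : 0 < ln 2 :> R by rewrite ln_gt0// ltr1n.
exists (((A + B) / ln 2 + B) / C + 1).
  rewrite ltr_wpDl// divr_ge0 ?(ltW C0)// addr_ge0// divr_ge0 ?(ltW l2)//.
  exact: addr_ge0.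
exists 2%N => // K /= K2.
apply: le_trans (fAB K K2) _.
have K0 : (0 : R) < K%:R by rewrite ltr0n; case: K K2.
have lK : ln 2 <= ln K%:R :> R by rewrite ler_ln ?posrE// ler_nat.
have lK1 : ln (K - 1)%:R <= ln K%:R :> R.
  by rewrite ler_ln ?posrE// ?ltr0n ?subn_gt0// ler_nat leq_subr.
have lK0 : 0 < ln K%:R :> R by exact: lt_le_trans lK.
rewrite [X in _ <= _ * X]ger0_norm; last by rewrite divr_ge0 ?ltW.
apply: (@le_trans _ _ (((A + B) / ln 2 + B) / C * (ln K%:R / K%:R)));
  last first.
  by rewrite ler_wpM2r ?lerDl ?ler01 ?divr_ge0 ?(ltW lK0) ?(ltW K0).
rewrite (_ : _ / C * (ln K%:R / K%:R) =
  ((A + B) / ln 2 + B) * ln K%:R / (K%:R * C)); last by field; lra.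
rewrite ler_wpM2r ?invr_ge0 ?(ltW (mulr_gt0 K0 C0))//.
have : A + B <= (A + B) / ln 2 * ln K%:R.
  by rewrite mulrAC ler_pdivlMr// ler_wpM2l// addr_ge0.
have := ler_wpM2l B0 lK1; lra.
Qed.

Theorem theorem2 (R : realType) (d : measure_display) (W : measurableType d)
    (P : probability W R) (m : nat)
    (Omega : set (m.-tuple R)) (D : m.-tuple R -> set (R * R))
    (S : nat -> {RV P >-> m.-tuple R}) (L M : m.-tuple R -> R)
    (Tmin Tmax Rmin Rmax C1 C2 : R)
    (thmin thmax theta0 b c tstar rstar : R)
    (phi : nat -> R * m.-tuple R -> R * R)
    (T Rw theta : nat -> {RV P >-> R})
    (thstar := optimal_ratio Omega D S) :
  renewal_system Omega D S L M ->
  moment_bounds Omega D S Tmin Tmax Rmin Rmax C1 C2 ->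
  thmin <= thstar <= thmax ->
  closure (achievable Omega D S) (tstar, rstar) ->
  thstar = rstar / tstar ->
  0 < c ->
  (forall t r : R, closure (achievable Omega D S) (t, r) ->
     r <= rstar + thstar * (t - tstar) - c / 2 * (t - tstar) ^+ 2) ->
  thmin <= theta0 <= thmax ->
  adaptive_run Omega D S thmin thmax theta0
    (fun k => 1 / ((k + 2)%:R * Tmin)) phi T Rw theta ->
  (forall k,
     (2^-1%:E * 'E_P[fun w => ((Rw k w - theta k w * T k w) ^+ 2)%R]
        <= b%:E)%E) ->
  (forall K : nat, (2 <= K)%N ->
     `|thstar - ratio_of_means T Rw K| <=
       (2 * (theta0 - thstar) ^+ 2
          + 4 * b / Tmin ^+ 2 * (1 + ln (K - 1)%:R)) / (K%:R * c * Tmin)) /\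
  ((fun K : nat => `|thstar - ratio_of_means T Rw K| : R^o) =O_\oo
     (fun K : nat => ln K%:R / K%:R : R^o)).
Proof.
move=> rs mb thsI star ths c0 curv th0I run bE.
have Tm0 := Tmin_gt0 mb.
have b0 : 0 <= b.
  rewrite -lee_fin; apply: le_trans (bE 0%N); rewrite mule_ge0 ?lee_fin//.
  by rewrite unlock; apply: integral_ge0 => w _; rewrite lee_fin sqr_ge0.
pose beta := 2 * b / Tmin ^+ 2.
have beta0 : 0 <= beta by rewrite divr_ge0 ?sqr_ge0// mulr_ge0.
pose z k := \int[P]_w (theta k w - thstar) ^+ 2.
have z0 : z 0%N = (theta0 - thstar) ^+ 2.
  rewrite /z; under eq_Rintegral do rewrite (run_init run).
  by rewrite Rintegral_cst// [X in fine X]probability_setT mulr1.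
have zrec k : z k.+1 <= (1 - 2 / (k + 2)%:R) * z k + beta / (k + 2)%:R ^+ 2.
  have k2 : (0 : R) < (k + 2)%:R by rewrite ltr0n addn2.
  have eta0 : 0 <= 1 / ((k + 2)%:R * Tmin) by rewrite divr_ge0// mulr_ge0// ltW.
  apply: le_trans
    (mean_sqdev_rec rs mb th0I run c0 thsI star ths curv eta0 (bE k)) _.
  rewrite le_eqVlt; apply/orP; left; apply/eqP; rewrite -/(z k) /beta.
  by field; rewrite !gt_eqF.
have zdecay := sqdev_decay beta0 zrec.
have main (K : nat) : (2 <= K)%N ->
    `|thstar - ratio_of_means T Rw K| <=
      (2 * (theta0 - thstar) ^+ 2
         + 4 * b / Tmin ^+ 2 * (1 + ln (K - 1)%:R)) / (K%:R * c * Tmin).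
  case: K => [|[|n]]// _; rewrite subSS subn0.
  have K0 : (0 : R) < n.+2%:R by rewrite ltr0n.
  have c20 : 0 <= 2 / c by rewrite divr_ge0// ltW.
  have -> : ratio_of_means T Rw n.+2 =
      (\sum_(0 <= k < n.+2) \int[P]_w Rw k w) /
      (\sum_(0 <= k < n.+2) \int[P]_w T k w).
    by congr (_ / _); apply: eq_bigr => k _; rewrite unlock.
  apply: le_trans (@ratio_gap R
    (fun k => \int[P]_w T k w) (fun k => \int[P]_w Rw k w) z
    Tmin thstar (2 / c) (z 0%N + beta * (1 + ln n.+1%:R)) n.+2 Tm0 c20
    (mean_duration_ge rs mb th0I run c0 star ths curv)
    (mean_gap_ge0 rs mb th0I run c0 star ths curv)
    (mean_gap_le rs mb th0I run c0 star ths curv) isT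
    (sum_sqdev_le beta0 zdecay n)) _.
  rewrite z0 /beta le_eqVlt; apply/orP; left; apply/eqP.
  by field; rewrite !gt_eqF.
split=> //.
apply: (@eqO_ln_div R (fun K => `|thstar - ratio_of_means T Rw K|)
  (2 * (theta0 - thstar) ^+ 2) (4 * b / Tmin ^+ 2) (c * Tmin)).
- by rewrite mulr_ge0 ?sqr_ge0.
- by rewrite divr_ge0 ?sqr_ge0// mulr_ge0.
- exact: mulr_gt0.
- by move=> K /main; rewrite normr_id mulrA.
Qed.
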